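(* Let $1/2<c\le 1$. There exists $n_0=n_0(c)$ such that for every $n\ge n_0$ the following holds. For every graph $G$ on $n$ vertices with $\delta(G)\ge cn$ and every proper edge-colouring $\chi$ of $G$, the graph $G$ contains a spanning linear forest with at most $\sqrt n$ components whose edges receive at least $cn-4\sqrt n$ distinct colours under $\chi$.
   Context: A linear forest is a graph each of whose components is a path (a single vertex counts as a path); it is spanning if it contains all vertices of $G$. A proper edge-colouring assigns colours to edges so that edges sharing a vertex receive different colours. *)

(* Defs.v *)
From HB Require Import structures.
From mathcomp Require Import all_boot all_order all_algebra.
From mathcomp Require Import reals.

Set Implicit Arguments.
Unset Strict Implicit.
Unset Printing Implicit Defensive.

Import Order.TTheory GRing.Theory Num.Theory.

Record sgraph (T : finType) := SGraph {
  adj :> rel T;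
  adj_sym : symmetric adj;
  adj_irrefl : irreflexive adj
}.

Section Graphs.
Variable T : finType.
Implicit Types G F : sgraph T.

Definition degree G (x : T) : nat := #|[set y | G x y]|.

(* Degrees never exceed #|T|, so this default does not affect the minimum;
   it only fixes the value 0 for the graph without vertices. *)
Definition min_degree G : nat := \big[minn/#|T|]_(x : T) degree G x.

Definition edges G : {set {set T}} :=
  [set A | [exists x, exists y, G x y && (A == [set x; y])]].

(* F and G share the vertex set T, so every subgraph in this sense is
   spanning. *)
Definition spanning_subgraph F G : Prop := edges F \subset edges G.

Definition consecutive (p : seq T) (u v : T) : bool :=
  infix [:: u; v] p || infix [:: v; u] p.

(* The subgraph of F induced on A is a path, whose vertices in order are
   listed by p; p = [:: x] is the one-vertex path. *)
Definition induces_path F (A : {set T}) : Prop :=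
  exists p : seq T, [/\ p != [::], uniq p, p =i A &
    {in A &, forall u v, F u v = consecutive p u v}].

Definition component F (x : T) : {set T} := [set y | connect F x y].

Definition components F : {set {set T}} := [set component F x | x : T].

Definition linear_forest F : Prop :=
  {in components F, forall A, induces_path F A}.

(* Edge-colourings are functions on all vertex sets, of which only the values
   on edges matter. *)
Definition proper_edge_colouring (C : eqType) G (chi : {set T} -> C) : Prop :=
  {in edges G &, forall A B : {set T},
    A != B -> A :&: B != set0 -> chi A != chi B}.

Definition num_colours (C : eqType) F (chi : {set T} -> C) : nat :=
  size (undup [seq chi A | A <- enum (edges F)]).

End Graphs.

(* Main.v *)
Require Import Defs.
From mathcomp Require Import all_boot all_order all_algebra.
From mathcomp Require Import reals boolp zify lra.

Set Implicit Arguments.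
Unset Strict Implicit.
Unset Printing Implicit Defensive.

Import Order.TTheory GRing.Theory Num.Theory.

(** A linear forest is represented by the list of its paths.  Among the spanning
    linear forests with exactly k = floor (sqrt n) paths, which exist by Dirac's
    argument, take one with the largest number m of colours, and call a colour
    free if a forest with k paths and m colours misses it.  If u starts a path,
    uv has a free colour and w precedes v, then replacing wv by uv adds a new
    colour, so by maximality the colour of wv must disappear: it occurs once and
    becomes free in turn.  Handling the k starting vertices one after another,
    each one enlarges the set of free colours of the forest by at least
    delta(G) - m - k.  If delta(G) > m + 4k this frees more than 3k^2 colours of
    the forest, while it has fewer than n < (k+1)^2 edges. *)

(** * Covers of the vertex set by disjoint paths, given as lists of vertices *)

Section PathCovers.
Variables (T : finType) (G : sgraph T).
Implicit Types (p q A B : seq T) (ps qs O : seq (seq T)).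

Fixpoint path_edges p : seq {set T} :=
  if p is x :: p' then
    if p' is y :: _ then [set x; y] :: path_edges p' else [::]
  else [::].

Definition cover_edges ps := flatten (map path_edges ps).

(** The permutation condition makes the paths disjoint and exhaustive at once; excluding [[::]]
    makes [size ps] the number of paths. *)
Definition path_cover ps :=
  [&& perm_eq (flatten ps) (enum T), [::] \notin ps & all (sorted G) ps].

Lemma path_edges_cat A w v B :
  path_edges (rcons A w ++ v :: B) =
  path_edges (rcons A w) ++ [set w; v] :: path_edges (v :: B).
Proof.
elim: A => [|x A IH] //=.
case: A IH => [|y A] IH //=.
by rewrite -[_ :: path_edges (v :: B)]/(path_edges (w :: v :: B)) -IH.
Qed.

Lemma path_edges_rcons2 A w v :
  path_edges (rcons (rcons A w) v) = rcons (path_edges (rcons A w)) [set w; v].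
Proof. by rewrite -(cats1 _ v) path_edges_cat /= cats1. Qed.

Lemma path_edges_rev p : path_edges (rev p) = rev (path_edges p).
Proof.
elim: p => // x [|y p] IH //=.
rewrite rev_cons rev_cons path_edges_rcons2 -rev_cons IH rev_cons.
by rewrite setUC.
Qed.

Lemma path_edgesP e p : e \in path_edges p ->
  exists A w v B, p = rcons A w ++ v :: B /\ e = [set w; v].
Proof.
elim: p => // x [|y p] IH //=.
rewrite inE => /predU1P[->|/IH[A [w [v [B [-> ->]]]]]].
  by exists [::], x, y, p.
by exists (x :: A), w, v, B.
Qed.

Lemma size_path_edges p : size (path_edges p) <= size p.
Proof. by elim: p => // x [|y p] IH //=; rewrite ltnS. Qed.

Lemma size_cover_edges ps : path_cover ps -> size (cover_edges ps) <= #|T|.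
Proof.
case/and3P=> /perm_size + _ _; rewrite -cardE => <-.
rewrite /cover_edges; elim: ps => //= p qs IH; rewrite !size_cat.
by rewrite leq_add // size_path_edges.
Qed.

Lemma perm_cover ps qs : perm_eq ps qs -> path_cover ps = path_cover qs.
Proof.
move=> pq; rewrite /path_cover (perm_mem pq) (perm_all _ pq).
by rewrite (permPl (perm_flatten pq)).
Qed.

Lemma perm_cover_edges ps qs :
  perm_eq ps qs -> perm_eq (cover_edges ps) (cover_edges qs).
Proof. by move=> pq; apply/perm_flatten/perm_map. Qed.

Lemma path_cover_rev p O : path_cover (rev p :: O) = path_cover (p :: O).
Proof.
rewrite /path_cover /= !inE.
have -> : ([::] == rev p) = ([::] == p).
  by rewrite !(eq_sym [::]) -!size_eq0 size_rev.
congr [&& _, _ & _ && _].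
  have /permPl -> // : perm_eq (rev p ++ flatten O) (p ++ flatten O).
  by rewrite perm_cat2r perm_rev.
by rewrite rev_sorted; apply: eq_sorted => x y; rewrite (adj_sym G).
Qed.

Lemma cover_edges_rev p O :
  perm_eq (cover_edges (rev p :: O)) (cover_edges (p :: O)).
Proof. by rewrite /cover_edges /= perm_cat2r path_edges_rev perm_rev. Qed.

(** An equation, so that it serves both to cut a path at the edge wv and to join two paths along
    it. *)
Lemma path_cover_join A w v B O :
  path_cover ((rcons A w ++ v :: B) :: O) =
  path_cover (rcons A w :: (v :: B) :: O) && G w v.
Proof.
have sr : sorted G (rcons (rcons A w) v) = sorted G (rcons A w) && G w v.
  by case: A => [|x A] /=; rewrite ?andbT // rcons_path last_rcons.
rewrite /path_cover /= !inE !(eq_sym [::]) -!size_eq0 size_cat !size_rcons.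
rewrite addSn /= -catA sorted_cat_cons sr.
case: (perm_eq _ _) => //=; case: (_ \notin _) => //=.
by rewrite -!andbA; case: (sorted _ _) => //=; case: (G w v); rewrite ?andbF ?andbT.
Qed.

Lemma cover_edges_join A w v B O :
  perm_eq (cover_edges ((rcons A w ++ v :: B) :: O))
    ([set w; v] :: cover_edges (rcons A w :: (v :: B) :: O)).
Proof.
rewrite /cover_edges [map _ _]/= [flatten _]/= path_edges_cat -catA.
exact/permEl/(perm_catCA _ [:: [set w; v]]).
Qed.

(** Reversing the path that starts at u moves u to its end, where the edge uv attaches the path
    starting at v. *)
Lemma path_cover_join_rev u a v B O :
    path_cover ((u :: a) :: (v :: B) :: O) -> G u v ->
  path_cover ((rcons (rev a) u ++ v :: B) :: O) /\
  perm_eq (cover_edges ((rcons (rev a) u ++ v :: B) :: O))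
    ([set u; v] :: cover_edges ((u :: a) :: (v :: B) :: O)).
Proof.
move=> cov uv; split.
  by rewrite path_cover_join uv -rev_cons path_cover_rev cov.
apply: (perm_trans (cover_edges_join _ _ _ _ _)).
by rewrite perm_cons -rev_cons cover_edges_rev.
Qed.

(** Cut wv, then attach the piece starting at v to the reversed piece ending in u. On u's own path w
    must precede v: otherwise u and v stay on the same piece and uv cannot join two pieces. Hence
    [q != u :: a] in the reversed alternative. The last two conclusions record surviving paths, so
    that other starting vertices can be followed through the move. *)
Lemma switch_edge qs u a q A w v B :
    path_cover qs -> u :: a \in qs -> q \in qs -> G u v ->
    q = rcons A w ++ v :: B \/ q != u :: a /\ rev q = rcons A w ++ v :: B ->
  exists qs' M,
  [/\ path_cover qs' /\ size qs' = size qs,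
      perm_eq (cover_edges qs) ([set w; v] :: M),
      perm_eq (cover_edges qs') ([set u; v] :: M),
      forall r, r \in qs -> r != u :: a -> r != q -> r \in qs' &
      q != u :: a -> rcons A w \in qs'].
Proof.
move=> cov ua_qs q_qs uv; case: (eqVneq q (u :: a)) => [q_ua [|[]//] q_eq|q_ua q_eq].
  pose O := rem q qs.
  have qsO : perm_eq qs (q :: O) by apply: perm_to_rem.
  have [a' Aw] : exists a', rcons A w = u :: a'.
    by case: A {q_qs} q_eq qsO => [|x A]; rewrite q_ua => -[<- _]; eexists.
  have covO : path_cover ((u :: a') :: (v :: B) :: O).
    by move: cov; rewrite (perm_cover qsO) q_eq path_cover_join Aw => /andP[].
  have [cov' edges'] := path_cover_join_rev covO uv.
  eexists; exists (cover_edges ((u :: a') :: (v :: B) :: O)).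
  split; first split; first exact: cov'.
  - by rewrite (perm_size qsO).
  - apply: perm_trans (perm_cover_edges qsO) _; rewrite q_eq -Aw.
    exact: cover_edges_join.
  - exact: edges'.
  - move=> r r_qs _ rq; rewrite inE; apply/orP; right.
    by move: r_qs; rewrite (perm_mem qsO) inE (negPf rq).
  - by [].
(* Two distinct paths: the cut leaves the pieces [u :: a], [v :: B] and [rcons A w]; the first two
   are joined and the third stays on its own. *)
pose O := rem q (rem (u :: a) qs).
have qsO : perm_eq qs ((u :: a) :: q :: O).
  apply: (perm_trans (perm_to_rem ua_qs)); rewrite perm_cons perm_to_rem //.
  by move: q_qs; rewrite (perm_mem (perm_to_rem ua_qs)) inE (negPf q_ua).
have qsO' : perm_eq qs (q :: (u :: a) :: O).
  by apply: (perm_trans qsO); exact/permEl/(perm_catCA [:: _] [:: _]).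
pose O' := rcons A w :: (v :: B) :: (u :: a) :: O.
have [covO edgesO] :
    path_cover O' /\ perm_eq (cover_edges qs) ([set w; v] :: cover_edges O').
  have [{}q_eq|[_ {}q_eq]] := q_eq.
    split; first by move: cov; rewrite (perm_cover qsO') q_eq path_cover_join => /andP[].
    by apply: perm_trans (perm_cover_edges qsO') _; rewrite q_eq cover_edges_join.
  split.
    by move: cov; rewrite (perm_cover qsO') -path_cover_rev q_eq path_cover_join => /andP[].
  apply: perm_trans (perm_cover_edges qsO') _.
  by rewrite -(permPl (cover_edges_rev _ _)) q_eq cover_edges_join.
have O'perm : perm_eq O' ((u :: a) :: (v :: B) :: rcons A w :: O).
  by apply/permP => f /=; rewrite /O' /=; lia.
have [] := @path_cover_join_rev u a v B (rcons A w :: O) _ uv.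
  by rewrite -(perm_cover O'perm).
move=> cov' edges'; eexists; exists (cover_edges O').
split; first split; first exact: cov'.
- by rewrite (perm_size qsO).
- exact: edgesO.
- apply: (perm_trans edges'); rewrite perm_cons perm_sym.
  exact: perm_cover_edges.
- move=> r + r_ua r_q; rewrite (perm_mem qsO) !inE (negPf r_ua) (negPf r_q) /=.
  by move->; rewrite !orbT.
- by rewrite !inE eqxx orbT.
Qed.

(** * Successors and predecessors along the paths, and merging of paths *)

Definition arc ps x v := has (infix [:: x; v]) ps.

Lemma arcP ps x v : reflect
  (exists A B, rcons A x ++ v :: B \in ps) (arc ps x v).
Proof.
apply: (iffP hasP) => [[p p_ps /infixP[A [B p_eq]]]|[A [B p_ps]]].
  by exists A, B; rewrite cat_rcons -[x :: _]/([:: x; v] ++ B) -p_eq.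
by exists (rcons A x ++ v :: B) => //; apply/infixP; exists A, B; rewrite cat_rcons.
Qed.

(** In the concatenation of all paths each vertex has one position, which an arc advances by one.
    Comparing positions later gives asymmetry of arcs and uniqueness of successors. *)
Lemma arc_index ps x v : path_cover ps -> arc ps x v ->
  index v (flatten ps) = (index x (flatten ps)).+1.
Proof.
case/and3P=> perm_ps _ _ /hasP[p p_ps /infixP[A [B p_eq]]].
have : uniq (flatten ps) by rewrite (perm_uniq perm_ps) enum_uniq.
have [C [D ->]] : exists C D, flatten ps = C ++ [:: x, v & D].
  case/splitPr: p_ps => qs qs'; exists (flatten qs ++ A), (B ++ flatten qs').
  by rewrite flatten_cat /= p_eq -!catA.
rewrite cat_uniq /= !negb_or => /and4P[_ /and3P[xC vC _]].
case/andP=> xv _ _.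
by rewrite !index_cat (negPf xC) (negPf vC) /= !eqxx (negPf xv) addn0 addn1.
Qed.

Lemma mem_cover ps x : path_cover ps -> exists2 p, p \in ps & x \in p.
Proof.
by case/and3P=> perm_ps _ _; apply/flattenP; rewrite (perm_mem perm_ps) mem_enum.
Qed.

Lemma arc_exists ps v : path_cover ps -> (forall B, v :: B \notin ps) ->
  exists x, arc ps x v.
Proof.
move=> cov vhead; have [p p_ps vp] := mem_cover v cov.
case/splitPr: vp p_ps => A B; case/lastP: A => [|A x] p_ps.
  by have := vhead B; rewrite p_ps.
by exists x; apply/arcP; exists A, B.
Qed.

Lemma cover_disjoint ps p q x :
  path_cover ps -> p \in ps -> q \in ps -> x \in p -> x \in q -> p = q.
Proof.
case/and3P=> perm_ps _ _.
have : uniq (flatten ps) by rewrite (perm_uniq perm_ps) enum_uniq.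
elim: ps {perm_ps} => //= r ps IH; rewrite cat_uniq => /and3P[_ /hasPn rps Ups].
rewrite !inE => /predU1P[->|p_ps] /predU1P[->|q_ps] // xp xq; last exact: IH.
  by have /rps/negP[] : x \in flatten ps by apply/flattenP; exists q.
by have /rps/negP[] : x \in flatten ps by apply/flattenP; exists p.
Qed.

(** In a path cover the default [v] is returned exactly at starting vertices, which have no
    predecessor; only the values at other vertices matter. *)
Definition pred_in ps v := odflt v [pick x | arc ps x v].

Lemma pred_inP ps v : path_cover ps -> (forall B, v :: B \notin ps) ->
  arc ps (pred_in ps v) v.
Proof.
move=> cov /(arc_exists cov)[x xv]; rewrite /pred_in.
by case: pickP => [//|/(_ x)]; rewrite xv.
Qed.

Lemma arc_inj ps x v v' : path_cover ps -> arc ps x v -> arc ps x v' -> v = v'.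
Proof.
move=> cov /(arc_index cov) iv /(arc_index cov); rewrite -iv => eq_index.
have mem_all y : y \in flatten ps.
  by case/and3P: cov => perm_ps _ _; rewrite (perm_mem perm_ps) mem_enum.
by rewrite -(nth_index x (mem_all v)) -eq_index nth_index.
Qed.

(** Dirac's argument with Ore's degree sums. Let u start one path and w end another, and suppose no
    merge is possible. Then no neighbour of u starts a path, so taking predecessors is injective on
    the neighbours of u; no such predecessor is adjacent to w, whence the degrees of u and w add up
    to at most [#|T|]. *)
Lemma path_cover_merge ps :
    path_cover ps -> 1 < size ps ->
    (forall x y, #|T| < degree G x + degree G y) ->
  exists2 qs, path_cover qs & (size qs).+1 = size ps.
Proof.
move=> cov ps_gt1 deg; apply: contrapT => no_merge.
have nil_ps : [::] \notin ps by case/and3P: cov.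
case: ps => [|[|u a] [|p2 O]] // in cov ps_gt1 nil_ps no_merge *.
case/lastP: p2 => [|b w] in cov ps_gt1 nil_ps no_merge *.
  by rewrite !inE eqxx ?orbT in nil_ps.
set ps := [:: u :: a, rcons b w & O] in cov ps_gt1 nil_ps no_merge *.
have step qs : path_cover qs -> (size qs).+1 = size ps -> False.
  by move=> *; apply: no_merge; exists qs.
have nhead v : G u v -> forall B, v :: B \notin ps.
  move=> uv B; apply/negP; rewrite /ps !inE => /or3P[/eqP[vu _]|/eqP vb|vO].
  - by rewrite vu adj_irrefl in uv.
  - move: cov; rewrite /ps -vb => /path_cover_join_rev-/(_ uv)[/step c _].
    exact: c.
  - have /perm_cover Operm : perm_eq ps [:: u :: a, v :: B, rcons b w & rem (v :: B) O].
      by have /permP Orem := perm_to_rem vO; apply/permP => f; rewrite /= Orem /=; lia.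
    move: cov; rewrite Operm => /path_cover_join_rev-/(_ uv)[/step c _].
    apply: c => /=; rewrite size_rem //; case: (O) vO => //.
have pred_arc v : G u v -> arc ps (pred_in ps v) v.
  by move=> uv; apply: pred_inP => // B; apply: nhead.
have inj : {in [set y | G u y] &, injective (pred_in ps)}.
  move=> v v'; rewrite !inE => /pred_arc arc_v /pred_arc arc_v' eq_pred.
  by apply: arc_inj cov arc_v _; rewrite eq_pred.
suff dis : [disjoint pred_in ps @: [set y | G u y] & [set y | G w y]].
  have := deg u w; rewrite /degree -(card_in_imset inj) ltnNge => /negP[].
  move: dis; rewrite -leq_card_setU => /eqP <-; exact: max_card.
(* Replacing the arc from x to v by the two edges uv and wx will give one path fewer; the cases are
   the positions of the arc. *)
apply/pred0Pn => -[x /= /andP[/imsetP[v]]]; rewrite !inE => uv x_v wx.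
have := pred_arc v uv; rewrite -{}x_v => /arcP[A [B]].
rewrite /ps !inE => /or3P[/eqP p_ua|/eqP p_bw|p_O].
(* Arc on the path of u: the merged path runs through b to w, then from x back to u, then from v
   on. *)
- have [a' Ax] : exists a', rcons A x = u :: a'.
    by case: (A) p_ua => [|y s] -[<- _]; eexists.
  move: cov; rewrite /ps -p_ua path_cover_join Ax => /andP[covO xv].
  have := path_cover_join_rev covO uv; rewrite -rev_cons -Ax rev_rcons.
  case=> cov' _; apply: (step ((rcons b w ++ (x :: rev A ++ v :: B)) :: O)) => //.
  rewrite path_cover_join wx andbT.
  rewrite -(perm_cover (permEl (perm_catCA [:: _] [:: _] _))).
  exact: cov'.
(* Arc on the path of w: the merged path runs through a backwards to u, from v to w, then from x
   back to the beginning. *)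
- have Operm : perm_eq [:: rcons A x ++ v :: B, u :: a & O] ps.
    by apply/permP => f; rewrite /ps -p_bw /=; lia.
  have [B' vB] : exists B', v :: B = rcons B' w.
    case/lastP: (B) p_bw => [|s z]; first by rewrite cats1 => /rcons_inj[_ ->]; exists [::].
    by rewrite -rcons_cons -rcons_cat => /rcons_inj[_ ->]; exists (v :: s).
  move: cov; rewrite -(perm_cover Operm) path_cover_join => /andP[cov xv].
  have Operm' : perm_eq [:: rcons A x, v :: B, u :: a & O]
      [:: u :: a, v :: B, rcons A x & O].
    by apply/permP => f /=; lia.
  move: cov; rewrite (perm_cover Operm') => /path_cover_join_rev-/(_ uv)[cov _].
  move: cov; rewrite vB -rcons_cat => cov.
  apply: (step ((rcons (rcons (rev a) u ++ B') w ++ x :: rev A) :: O)) => //.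
  rewrite path_cover_join wx andbT -rev_rcons.
  move: cov; have /perm_cover -> : perm_eq [:: rcons (rcons (rev a) u ++ B') w, rcons A x & O]
     [:: rcons A x, rcons (rcons (rev a) u ++ B') w & O] by apply/permP => f /=; lia.
  rewrite -path_cover_rev => cov.
  by have /perm_cover <- : perm_eq [:: rev (rcons A x), rcons (rcons (rev a) u ++ B') w & O]
     [:: rcons (rcons (rev a) u ++ B') w, rev (rcons A x) & O] by apply/permP => f /=; lia.
(* Arc on a third path: its part from v on is attached to u and its part up to x to w, so three
   paths become two. *)
- set p := _ ++ _ in p_O; pose O' := rem p O.
  have /permP Orem := perm_to_rem p_O.
  have /perm_cover Operm : perm_eq ps [:: p, u :: a, rcons b w & O'].
    by apply/permP => f; rewrite /= Orem /= -/O'; lia.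
  move: cov; rewrite Operm path_cover_join => /andP[cov xv].
  move: cov; have /perm_cover -> : perm_eq
      [:: rcons A x, v :: B, u :: a, rcons b w & O']
      [:: u :: a, v :: B, rcons A x, rcons b w & O'] by apply/permP => f /=; lia.
  move/path_cover_join_rev => /(_ uv)[+ _]; set p' := _ ++ _.
  have /perm_cover -> : perm_eq [:: p', rcons A x, rcons b w & O']
      [:: rcons A x, rcons b w, p' & O'] by apply/permP => f /=; lia.
  rewrite -path_cover_rev rev_rcons.
  have /perm_cover -> : perm_eq [:: x :: rev A, rcons b w, p' & O']
      [:: rcons b w, x :: rev A, p' & O'] by apply/permP => f /=; lia.
  move=> cov; apply: (step ((rcons b w ++ x :: rev A) :: p' :: O')).
    by rewrite path_cover_join cov.
  by rewrite /= size_rem //; case: (O) p_O.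
Qed.

Lemma path_cover_singletons : path_cover [seq [:: x] | x <- enum T].
Proof.
rewrite /path_cover flatten_map1 map_id perm_refl /=.
by apply/andP; split; [apply/mapP => -[] | apply/allP => p /mapP[x _ ->]].
Qed.

Lemma path_cover_of_size k :
    0 < k <= #|T| -> (forall x y, #|T| < degree G x + degree G y) ->
  exists2 ps, path_cover ps & size ps = k.
Proof.
move=> /andP[k_gt0 k_le] deg.
suff H j : j < #|T| -> exists2 ps, path_cover ps & size ps = #|T| - j.
  by have [|ps cov sz] := H (#|T| - k); [lia | exists ps => //; lia].
elim: j => [|j IH] j_lt.
  by exists [seq [:: x] | x <- enum T]; rewrite ?path_cover_singletons // size_map -cardE subn0.
have [ps cov sz] := IH (ltnW j_lt).
by have [|qs covq szq] := path_cover_merge cov _ deg; [lia | exists qs => //; lia].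
Qed.

End PathCovers.

(** * Colours of path covers and the switching argument *)

Section Switching.
Variables (T : finType) (G : sgraph T) (C : eqType) (chi : {set T} -> C).
Hypothesis proper_chi : proper_edge_colouring G chi.
Implicit Types (p q A B : seq T) (ps qs : seq (seq T)) (S : seq C) (u v w : T).

Definition cover_colours ps := map chi (cover_edges ps).

Definition colour_count ps := size (undup (cover_colours ps)).

Lemma mem_edges u v : G u v -> [set u; v] \in edges G.
Proof. by move=> uv; rewrite inE; apply/existsP; exists u; apply/existsP; exists v; rewrite uv eqxx. Qed.

Lemma proper_colour_inj u v v' :
  G u v -> G u v' -> chi [set u; v] = chi [set u; v'] -> v = v'.
Proof.
move=> uv uv' eq_chi; apply/eqP/contraT => vv'.
suff: chi [set u; v] != chi [set u; v'] by rewrite eq_chi eqxx.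
apply: proper_chi; rewrite ?mem_edges //.
  apply: contra vv' => /eqP/setP/(_ v); rewrite !inE eqxx orbT => /esym/orP[/eqP vu|//].
  by rewrite vu adj_irrefl in uv.
by apply/set0Pn; exists u; rewrite !inE eqxx.
Qed.

Lemma set2_eq u v u' v' : [set u; v] = [set u'; v'] :> {set T} ->
  (u = u' /\ v = v') \/ (u = v' /\ v = u').
Proof.
move=> e; have: u \in [set u'; v'] by rewrite -e set21.
have: v \in [set u'; v'] by rewrite -e set22.
have: u' \in [set u; v] by rewrite e set21.
have: v' \in [set u; v] by rewrite e set22.
by rewrite !inE => /pred2P[]-> /pred2P[]-> /pred2P[]? /pred2P[]?; subst; auto.
Qed.

Lemma arc_asym ps u v : path_cover G ps -> arc ps u v -> arc ps v u -> False.
Proof. by move=> cov /(arc_index cov) h /(arc_index cov); rewrite h; lia. Qed.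

Lemma arc_adj ps u v : path_cover G ps -> arc ps u v -> G u v.
Proof.
move=> /and3P[_ _ /allP srt] /hasP[p /srt srtp /infix_sorted].
by move/(_ _ srtp) => /=; rewrite andbT.
Qed.

Lemma cover_edgesP ps e : reflect
  (exists u v, arc ps u v /\ e = [set u; v]) (e \in cover_edges ps).
Proof.
apply: (iffP flattenP) => [[s /mapP[p p_ps ->] /path_edgesP]|[u [v []]]].
  case=> A [w [v [B [p_eq ->]]]]; exists w, v; split=> //.
  by apply/arcP; exists A, B; rewrite -p_eq.
move=> /arcP[A [B p_ps]] ->; exists (path_edges (rcons A u ++ v :: B)); first exact: map_f.
by rewrite path_edges_cat mem_cat inE eqxx orbT.
Qed.

Lemma arc_edge_inj ps u v u' v' : path_cover G ps -> arc ps u v -> arc ps u' v' ->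
  [set u; v] = [set u'; v'] -> u = u' /\ v = v'.
Proof.
move=> cov uv uv' /set2_eq[//|[uv'_eq vu']]; case: (arc_asym cov uv).
by rewrite uv'_eq vu'.
Qed.

Lemma colour_count_edges ps e M : perm_eq (cover_edges ps) (e :: M) ->
  colour_count ps = (chi e \notin map chi M) + size (undup (map chi M)).
Proof.
move=> psM; rewrite /colour_count /cover_colours.
have -> : size (undup (map chi (cover_edges ps))) = size (undup (map chi (e :: M))).
  by apply/perm_size/perm_undup/perm_mem/perm_map.
by rewrite /=; case: ifP.
Qed.

(** The covers share the edges in M. The colour of [e'] is new, so [qs'] has exactly one colour more
    than M; since it has at most m colours, M must lack a colour of [qs], which can only be that of
    [e]. *)
Lemma exchange_unique_colour m qs qs' M e e' :
    perm_eq (cover_edges qs) (e :: M) -> perm_eq (cover_edges qs') (e' :: M) ->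
    chi e' \notin cover_colours qs -> colour_count qs = m -> colour_count qs' <= m ->
  [/\ colour_count qs' = m, chi e \notin cover_colours qs' &
      {in cover_edges qs, forall f, chi f = chi e -> f = e}].
Proof.
move=> qsM qsM' e'_qs /(etrans (esym (colour_count_edges qsM))) m_eq.
rewrite (colour_count_edges qsM').
have e'M : chi e' \notin chi e :: map chi M.
  by move: e'_qs; rewrite /cover_colours (perm_mem (perm_map _ qsM)).
move: (e'M); rewrite inE negb_or => /andP[e'e ->].
case eM : (chi e \in map chi M) m_eq => /= m_eq; first by lia.
move=> _; split=> [//||f].
  by rewrite /cover_colours (perm_mem (perm_map _ qsM')) inE eq_sym (negPf e'e) eM.
rewrite (perm_mem qsM) inE => /predU1P[//|fM] fe.
by move: eM; rewrite -fe map_f.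
Qed.

Definition heads ps := pmap ohead ps.

Lemma mem_heads ps v : reflect (exists B, v :: B \in ps) (v \in heads ps).
Proof.
rewrite /heads mem_pmap; apply: (iffP mapP) => [[[|x p] //= p_ps [->]]|[B B_ps]].
  by exists p.
by exists (v :: B).
Qed.

Variables (ps : seq (seq T)) (d : nat).
Hypothesis cov_ps : path_cover G ps.
Hypothesis ps_max : forall qs, path_cover G qs -> size qs = size ps ->
  colour_count qs <= colour_count ps.
Hypothesis deg_ge : forall x, d <= degree G x.

(* All colours in S, as well as those absent from ps, can be avoided by a cover
   that is as good as ps; that cover retains the starting vertices in rest. *)
Definition avoidable S (rest : seq (seq T)) :=
  [/\ uniq S, {subset S <= cover_colours ps},
      {in cover_edges ps &, forall e f, chi e \in S -> chi e = chi f -> e = f} &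
      forall gamma, gamma \notin cover_colours ps \/ gamma \in S ->
      exists qs, [/\ path_cover G qs /\ size qs = size ps, gamma \notin cover_colours qs,
        colour_count qs = colour_count ps,
        {in rest, forall P, exists r, [/\ r != [::], prefix r P & r \in qs]} &
        {in cover_edges ps, forall e, e \notin cover_edges qs -> chi e \in S}]].

Lemma avoidable0 : avoidable [::] ps.
Proof.
split=> // gamma [gamma_ps|//]; exists ps; split=> // [P P_ps|e -> //].
exists P; split=> //; last exact: prefix_refl.
by apply: contraTneq P_ps => ->; case/and3P: cov_ps.
Qed.

Definition switchable S u v :=
  [&& G u v, v \notin heads ps &
      (chi [set u; v] \notin cover_colours ps) || (chi [set u; v] \in S)].

Lemma switchable_arc S u v : switchable S u v -> arc ps (pred_in ps v) v.
Proof.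
case/and3P=> _ /mem_heads vh _; apply: pred_inP cov_ps _ => B.
by apply/negP => B_ps; apply: vh; exists B.
Qed.

(** A neighbour v of u fails to be switchable only if it starts a path or uv has a colour of [ps]
    outside S. The first happens at most [size ps] times and, the colouring being proper, the second
    at most [colour_count ps - size S] times. *)
Lemma card_switchable S u : uniq S -> {subset S <= cover_colours ps} ->
  d + size S <= #|[set v | switchable S u v]| + size ps + colour_count ps.
Proof.
move=> uS sub_S; pose Cs := [seq x <- undup (cover_colours ps) | x \notin S].
have sizeCs : size Cs + size S = colour_count ps.
  rewrite /colour_count -(count_predC (mem S) (undup _)) addnC [size Cs]size_filter.
  congr (_ + _); rewrite -size_filter; apply/perm_size/uniq_perm => // [|x].
    by rewrite filter_uniq // undup_uniq.
  rewrite mem_filter mem_undup /=.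
  by case xS: (x \in S) => //=; rewrite sub_S.
pose X := [set v in heads ps]; pose Y := [set v | G u v && (chi [set u; v] \in Cs)].
have cardX : #|X| <= size ps.
  by rewrite cardsE (leq_trans (card_size _)) // size_pmap count_size.
have cardY : #|Y| <= size Cs.
  rewrite cardE -(size_map (fun v => chi [set u; v])); apply: uniq_leq_size.
    rewrite map_inj_in_uniq ?enum_uniq // => v v'; rewrite !mem_enum !inE.
    by move=> /andP[uv _] /andP[uv' _]; apply: proper_colour_inj.
  by move=> _ /mapP[v + ->]; rewrite mem_enum inE => /andP[].
have : degree G u <= #|[set v | switchable S u v]| + #|X| + #|Y|.
  apply: (@leq_trans #|[set v | switchable S u v] :|: X :|: Y|); last first.
    rewrite (leq_trans (leq_card_setU _ _)) // leq_add2r.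
    by rewrite (leq_trans (leq_card_setU _ _)).
  apply/subset_leq_card/subsetP => v; rewrite !inE /switchable => uv.
  rewrite uv mem_filter mem_undup /=.
  by case: (v \in heads ps) => //=; case: (_ \in S); case: (_ \in cover_colours ps).
have := deg_ge u; lia.
Qed.

(** Let u start P, let v be switchable for u and w its predecessor in [ps]. If the colour of wv is
    not in S, a cover missing the colour of uv still contains wv, and exchanging wv for uv frees the
    colour of wv. [S'] collects these colours, one for each v; as S grows there are more switchable
    v, so the gains accumulate. *)
Lemma avoidable_step S P rest : uniq (P :: rest) -> {subset P :: rest <= ps} ->
    avoidable S (P :: rest) ->
  exists2 S', avoidable S' rest &
    d + size S <= size S' + size ps + colour_count ps.
Proof.
move=> uPr sub_rest [uS sub_S inj_S avoid_S].
have [u [a P_eq]] : exists u a, P = u :: a.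
  have : P \in ps by apply: sub_rest; rewrite inE eqxx.
  case: (P) => [nil_ps|u a _]; last by exists u, a.
  by case/and3P: cov_ps; rewrite nil_ps.
have P_ps : P \in ps by apply: sub_rest; rewrite mem_head.
pose N := [set v | switchable S u v].
pose c v := chi [set pred_in ps v; v].
pose S' := undup (S ++ [seq c v | v <- enum N]).
have S_S' : {subset S <= S'} by move=> x xS; rewrite mem_undup mem_cat xS.
have c_S' v : v \in N -> c v \in S'.
  by move=> vN; rewrite mem_undup mem_cat map_f ?orbT // mem_enum.
have arc_N v : v \in N -> arc ps (pred_in ps v) v.
  by rewrite inE => /switchable_arc.
have edge_N v : v \in N -> [set pred_in ps v; v] \in cover_edges ps.
  by move=> vN; apply/cover_edgesP; exists (pred_in ps v), v; split=> //; apply: arc_N.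
have key v : v \in N -> c v \notin S ->
    {in cover_edges ps, forall f, chi f = c v -> f = [set pred_in ps v; v]} /\
    exists qs, [/\ path_cover G qs /\ size qs = size ps, c v \notin cover_colours qs,
        colour_count qs = colour_count ps,
        {in rest, forall R, exists r, [/\ r != [::], prefix r R & r \in qs]} &
        {in cover_edges ps, forall e, e \notin cover_edges qs -> chi e \in S'}].
  move=> vN cvS; have wv := arc_N v vN; have wv_ps := edge_N v vN.
  rewrite /c in cvS *; set w := pred_in ps v in cvS wv wv_ps *.
  move: (vN); rewrite inE => /and3P[uv _ /orP/avoid_S].
  case=> qs [[cov_qs size_qs] uv_qs count_qs prefix_qs edges_qs].
  (* The edges of [ps] missing from [qs] all have colours in S. *)
  have wv_qs : [set w; v] \in cover_edges qs.
    by apply: contraNT cvS => /edges_qs; apply.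
  have [r [r_nil r_P r_qs]] := prefix_qs P (mem_head _ _).
  have [a' r_eq] : exists a', r = u :: a'.
    case: (r) r_nil r_P => // x r' _; rewrite P_eq /= => /andP[/eqP-> _].
    by exists r'.
  rewrite {r r_nil}r_eq in r_P r_qs.
  (* [qs] may traverse wv in either direction. A path going from v to w is no prefix of a path of
     [ps], where w precedes v; this separates it from the path starting at u and from the prefixes
     kept for [rest]. *)
  have [q [A [B [q_qs q_wv]]]] : exists q A B, q \in qs /\
      (q = rcons A w ++ v :: B \/
       rev q = rcons A w ++ v :: B /\ {in ps, forall R, ~~ prefix q R}).
    have /flattenP[s /mapP[q q_qs ->]] := wv_qs.
    case/path_edgesP=> A [w' [v' [B [q_eq /set2_eq[[-> ->]|[ww' vv']]]]]].
      by exists q, A, B; split=> //; left.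
    exists q, (rev B), (rev A); split=> //; right; split=> [|R R_ps].
      by rewrite q_eq ww' vv' rev_cat rev_cons rev_rcons.
    apply/negP => /prefixP[B' R_eq]; apply: (arc_asym cov_ps wv); apply/arcP.
    exists A, (B ++ B').
    by rewrite ww' vv' -[v' :: _]/((v' :: B) ++ B') catA -q_eq -R_eq.
  have q_wv' : q = rcons A w ++ v :: B \/
      q != u :: a' /\ rev q = rcons A w ++ v :: B.
    case: q_wv => [|[q_eq q_pre]]; [by left | right; split=> //].
    by apply: contraTneq r_P => <-; apply: q_pre.
  have [qs' [M [[cov_qs' size_qs'] qsM qsM' keep_qs' cut_qs']]] :=
    switch_edge cov_qs r_qs q_qs uv q_wv'.
  have [|count_qs' wv_qs' uniq_wv] := exchange_unique_colour qsM qsM' uv_qs count_qs.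
    by apply: ps_max => //; rewrite size_qs'.
  (* An edge of [ps] whose colour is outside S is still in [qs], so uniqueness of the colour in [qs]
     carries over to [ps]. *)
  split=> [f f_ps f_c|].
    apply: (uniq_wv f _ f_c); apply: contraNT cvS; rewrite -f_c.
    exact: edges_qs.
  exists qs'; split=> //; first by rewrite size_qs'.
    move=> R R_rest.
    have R_ps : R \in ps by apply: sub_rest; rewrite inE R_rest orbT.
    have [|r [r_nil r_R r'_qs]] := prefix_qs R; first by rewrite inE R_rest orbT.
    (* Otherwise P and R share u and coincide, against [uniq (P :: rest)]. *)
    have r_ua : r != u :: a'.
      apply: contraTneq uPr => r_eq; rewrite /= negb_and negbK.
      suff -> : P = R by rewrite R_rest.
      apply: (cover_disjoint cov_ps P_ps R_ps (x := u)).
        by rewrite P_eq mem_head.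
      by case/prefixP: r_R => B' ->; rewrite r_eq mem_head.
    (* If the kept prefix of R is the path being cut, it is oriented as in [ps], and its part up to
       w is again a prefix of R. *)
    have [r_q|r_q] := eqVneq r q; last by exists r; split=> //; apply: keep_qs'.
    case: q_wv => [q_eq|[_ /(_ R R_ps)]]; last by rewrite -r_q r_R.
    exists (rcons A w); split; last by apply: cut_qs'; rewrite -r_q.
      by rewrite -size_eq0 size_rcons.
    apply: prefix_trans r_R; rewrite r_q q_eq; exact: prefix_prefix.
  (* The switch loses only wv beyond what [qs] had lost, and its colour lies in [S']. *)
  move=> e e_ps e_qs'; have [e_qs|/(edges_qs e e_ps)/S_S' //] := boolP (e \in cover_edges qs).
  move: e_qs e_qs'; rewrite (perm_mem qsM) (perm_mem qsM') !inE negb_or.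
  by move=> /predU1P[-> _|-> /andP[]//]; apply: c_S'.
have c_inj : {in N, forall v, {in cover_edges ps, forall f, chi f = c v ->
    f = [set pred_in ps v; v]}}.
  move=> v vN f f_ps f_c; have [cS|/(key v vN)[+ _]] := boolP (c v \in S).
    by apply: (inj_S f _ f_ps (edge_N v vN) _ f_c); rewrite f_c.
  by apply.
exists S'; first split.
- exact: undup_uniq.
- move=> x; rewrite mem_undup mem_cat => /orP[/sub_S //|/mapP[v]].
  by rewrite mem_enum => vN ->; apply/map_f/edge_N.
- move=> e f e_ps f_ps; rewrite mem_undup mem_cat => /orP[eS|/mapP[v]].
    exact: inj_S.
  rewrite mem_enum => vN e_c ef.
  by rewrite (c_inj v vN e) // (c_inj v vN f) // -ef.
- move=> gamma gamma_free.
  have [gamma_S|gamma_S] := pselect (gamma \notin cover_colours ps \/ gamma \in S).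
    have [qs [? ? ? prefix_qs edges_qs]] := avoid_S gamma gamma_S.
    exists qs; split=> // [R R_rest|e e_ps /(edges_qs e e_ps)/S_S' //].
    by apply: prefix_qs; rewrite inE R_rest orbT.
  case: gamma_free => [?|]; first by case: gamma_S; left.
  rewrite mem_undup mem_cat => /orP[?|/mapP[v]]; first by case: gamma_S; right.
  rewrite mem_enum => vN gamma_c.
  have [|_] := key v vN; first by apply/negP => cS; apply: gamma_S; right; rewrite gamma_c.
  by rewrite gamma_c.
(* It remains to bound [#|N|] by [size S']: the colour [c v] marks a single edge of [ps], whose arc
   determines v. *)
apply: leq_trans (card_switchable u uS sub_S) _; rewrite !leq_add2r cardE.
rewrite -(size_map c); apply: uniq_leq_size => [|x xc]; last by rewrite mem_undup mem_cat xc orbT.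
rewrite map_inj_in_uniq ?enum_uniq // => v v'; rewrite !mem_enum => vN v'N eq_c.
by case: (arc_edge_inj cov_ps (arc_N v vN) (arc_N v' v'N) (c_inj v' v'N _ (edge_N v vN) eq_c)).
Qed.

Lemma colour_count_lower_bound : 0 < size ps -> #|T| < (size ps).+1 ^ 2 ->
  d <= colour_count ps + 4 * size ps.
Proof.
move=> ps_gt0 T_lt; rewrite leqNgt; apply/negP => d_gt.
have uniq_ps : uniq ps.
  case/and3P: cov_ps => /perm_uniq; rewrite enum_uniq => + nil_ps _.
  elim: (ps) nil_ps => //= p qs IH; rewrite inE negb_or cat_uniq => /andP[p_nil nil_qs].
  case/and3P=> _ /hasPn disj /(IH nil_qs)->; rewrite andbT.
  case: p p_nil disj => // x p _ disj; apply/negP => p_qs.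
  have /disj : x \in flatten qs by apply/flattenP; exists (x :: p); rewrite ?mem_head.
  by rewrite /= mem_head.
(* With k = [size ps], the assumed failure puts d at least 4k + 1 above the number of colours; a
   step loses k of this, so it gains at least 3k + 1. *)
have stage i : i <= size ps ->
    exists2 S, avoidable S (drop i ps) & i * (3 * size ps).+1 <= size S.
  elim: i => [|i IH] i_lt; first by exists [::]; rewrite ?drop0 //; apply: avoidable0.
  have [S] := IH (ltnW i_lt); rewrite (drop_nth [::]) // => avoid_S size_S.
  have [||S' avoid_S' size_S'] := avoidable_step _ _ avoid_S.
  - by rewrite -drop_nth // drop_uniq.
  - by move=> p; rewrite -drop_nth //; apply: mem_drop.
  by exists S' => //; rewrite mulSn; lia.
have [S [uS sub_S _ _] size_S] := stage _ (leqnn _).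
have : size S <= #|T|.
  rewrite (leq_trans (uniq_leq_size uS sub_S)) // size_map.
  exact: size_cover_edges cov_ps.
(* With k = [size ps], this reads 3k^2 + k <= [#|T|] <= k^2 + 2k, impossible for k >= 1. *)
nia.
Qed.

End Switching.

(** * The graph formed by the edges of a path cover *)

Section CoverGraph.
Variables (T : finType) (G : sgraph T) (ps : seq (seq T)).
Hypothesis cov : path_cover G ps.
Implicit Types (p : seq T) (u v x y : T).

Lemma cover_graph_sym : symmetric (fun u v => arc ps u v || arc ps v u).
Proof. by move=> u v; rewrite orbC. Qed.

Lemma cover_graph_irrefl : irreflexive (fun u v => arc ps u v || arc ps v u).
Proof.
by move=> u; rewrite orbb; apply/negP => /(arc_adj cov); rewrite adj_irrefl.
Qed.

Definition cover_graph := SGraph cover_graph_sym cover_graph_irrefl.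

Lemma edges_cover_graph : edges cover_graph =i cover_edges ps.
Proof.
move=> e; rewrite inE; apply/existsP/cover_edgesP => [[u /existsP[v]]|[u [v [uv ->]]]].
  case/andP=> /orP[] uv /eqP->; first by exists u, v.
  by exists v, u; rewrite setUC.
by exists u; apply/existsP; exists v; rewrite /= uv eqxx.
Qed.

Lemma cover_graph_spanning : spanning_subgraph cover_graph G.
Proof.
apply/subsetP => e; rewrite edges_cover_graph => /cover_edgesP[u [v [uv ->]]].
exact/mem_edges/(arc_adj cov).
Qed.

Lemma num_colours_cover_graph (C : eqType) (chi : {set T} -> C) :
  num_colours cover_graph chi = colour_count chi ps.
Proof.
apply/perm_size/perm_undup/eq_mem_map => e.
by rewrite mem_enum edges_cover_graph.
Qed.

Lemma arc_mem p u v : p \in ps -> arc ps u v -> u \in p \/ v \in p ->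
  [/\ u \in p, v \in p & infix [:: u; v] p].
Proof.
move=> p_ps /hasP[q q_ps uv_q] uv_p.
have uq : u \in q by apply: (mem_infix uv_q); rewrite mem_head.
have vq : v \in q by apply: (mem_infix uv_q); rewrite !inE eqxx orbT.
suff pq : p = q by rewrite pq.
by case: uv_p => xp; apply: (cover_disjoint cov p_ps q_ps xp).
Qed.

(** By disjointness an arc touching p lies on p, so p is closed under adjacency; conversely, all its
    vertices are connected to its first one. *)
Lemma component_cover_graph p x : p \in ps -> x \in p ->
  component cover_graph x =i p.
Proof.
move=> p_ps xp y; rewrite inE; apply/idP/idP => [xy|yp].
  rewrite -(closed_connect (a := mem p) _ xy) // => u v /orP[] uv; apply/idP/idP => ?;
  by case: (arc_mem p_ps uv); auto.
case: p => // z p in p_ps xp yp *.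
have sorted_p : path cover_graph z p.
  apply/(pathP z) => i i_lt; apply/orP; left; apply/hasP; exists (z :: p) => //.
  apply/infixP; exists (take i (z :: p)), (drop i.+1 p).
  rewrite -[LHS](cat_take_drop i); congr (_ ++ _).
  by rewrite (drop_nth z (s := z :: p) (leqW i_lt)) /= (drop_nth z i_lt).
have z_connect := path_connect sorted_p.
apply: (connect_trans (y := z)); last exact: z_connect.
rewrite (_ : connect _ x z = connect cover_graph z x); first exact: z_connect.
by apply: sym_connect_sym => u v; rewrite adj_sym.
Qed.

Lemma cover_graph_linear_forest : linear_forest cover_graph.
Proof.
move=> _ /imsetP[x _ ->]; have [p p_ps xp] := mem_cover x cov.
exists p; split.
- by apply: contraTneq xp => ->.
- have /and3P[/perm_uniq + _ _] := cov; rewrite enum_uniq.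
  by case/splitPr: p_ps => A B; rewrite flatten_cat cat_uniq /= cat_uniq => /and4P[_ _ ->].
- by move=> y; rewrite (component_cover_graph p_ps xp).
- move=> u v; rewrite !(component_cover_graph p_ps xp) /= => up vp.
  apply/orP/orP => -[uv|uv].
  + by case: (arc_mem p_ps uv); auto.
  + by case: (arc_mem p_ps uv); auto.
  + by left; apply/hasP; exists p.
  + by right; apply/hasP; exists p.
Qed.

Lemma card_components_cover_graph : #|components cover_graph| <= size ps.
Proof.
rewrite cardE -(size_map (fun p => [set y in p])).
apply: uniq_leq_size (enum_uniq _) _ => A; rewrite mem_enum => /imsetP[x _ ->].
have [p p_ps xp] := mem_cover x cov; apply/mapP; exists p => //.
by apply/setP => y; rewrite (component_cover_graph p_ps xp) inE.
Qed.

End CoverGraph.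

(** * The extremal cover and the conclusion *)

Lemma min_degree_le (T : finType) (G : sgraph T) x : min_degree G <= degree G x.
Proof.
rewrite /min_degree; have := mem_index_enum x.
elim: (index_enum T) => // y s IH; rewrite inE big_cons.
by case/predU1P=> [<-|/IH]; rewrite geq_min ?leqnn // => ->; rewrite orbT.
Qed.

(** Merging provides covers by k paths because [#|T| < d + d]. Their colour counts are at most
    [#|T|], so a maximum is attained, and the switching bound applies to it. *)
Lemma colourful_path_cover (T : finType) (G : sgraph T) (C : eqType)
    (chi : {set T} -> C) (k d : nat) :
    proper_edge_colouring G chi -> 0 < k -> k ^ 2 <= #|T| < k.+1 ^ 2 ->
    (forall x, d <= degree G x) -> #|T| < d + d ->
  exists ps, [/\ path_cover G ps, size ps = k & d <= colour_count chi ps + 4 * k].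
Proof.
move=> proper_chi k_gt0 /andP[k_le lt_k] deg T_lt.
pose good m := `[< exists ps, [/\ path_cover G ps, size ps = k & colour_count chi ps = m] >].
have ex_good : exists m, good m.
  have [|x y|ps cov size_ps] := @path_cover_of_size T G k.
  - by rewrite k_gt0; nia.
  - by have := deg x; have := deg y; lia.
  by exists (colour_count chi ps); apply/asboolP; exists ps.
have good_le m : good m -> m <= #|T|.
  case/asboolP=> ps [cov _ <-]; apply: leq_trans (size_undup _) _.
  by rewrite size_map (size_cover_edges cov).
have [m /asboolP[ps [cov size_ps m_eq]] m_max] := ex_maxnP ex_good good_le.
exists ps; split=> //; rewrite -size_ps.
apply: colour_count_lower_bound cov _ deg _ _ => //; rewrite ?size_ps //.
by move=> qs cov_qs size_qs; rewrite m_eq; apply/m_max/asboolP; exists qs; rewrite size_qs.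
Qed.

Local Open Scope ring_scope.

Theorem theorem1p4 (R : realType) (c : R) (hc : 1 / 2 < c) (hc1 : c <= 1) :
  exists n0 : nat, forall n : nat, (n0 <= n)%N ->
  forall (T : finType) (G : sgraph T), #|T| = n ->
    c * n%:R <= (min_degree G)%:R ->
  forall (C : eqType) (chi : {set T} -> C), proper_edge_colouring G chi ->
  exists F : sgraph T,
    [/\ spanning_subgraph F G,
        linear_forest F,
        (#|components F|)%:R <= Num.sqrt (n%:R : R) &
        c * n%:R - 4 * Num.sqrt n%:R <= (num_colours F chi)%:R].
Proof.
(* Positivity of n suffices: it yields k >= 1 and, with c > 1/2, the strict inequality between n and
   twice the minimum degree. *)
exists 1%N => n n_gt0 T G T_n deg C chi proper_chi.
have [k k_le lt_k] : exists2 k, (k ^ 2 <= n)%N & (n < k.+1 ^ 2)%N.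
  have ex_sq : exists k, (k ^ 2 <= n)%N by exists 0%N.
  have sq_le k : (k ^ 2 <= n -> k <= n)%N by move=> k_le; nia.
  have [k k_le k_max] := ex_maxnP ex_sq sq_le.
  by exists k => //; rewrite ltnNge; apply/negP => /k_max; rewrite ltnn.
have k_gt0 : (0 < k)%N by case: (k) lt_k => //; lia.
have k_sqrt : k%:R <= Num.sqrt (n%:R : R).
  by rewrite -(ler_sqr (ler0n _ _) (sqrtr_ge0 _)) sqr_sqrtr ?ler0n // -natrX ler_nat.
have deg_gt : (#|T| < min_degree G + min_degree G)%N.
  rewrite T_n -(ltr_nat R) natrD; have : 0 < n%:R :> R by rewrite ltr0n.
  nra.
have [|ps [cov size_ps count_ps]] :=
  colourful_path_cover proper_chi k_gt0 _ (@min_degree_le T G) deg_gt.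
  by rewrite T_n k_le.
exists (cover_graph cov); split.
- exact: cover_graph_spanning.
- exact: cover_graph_linear_forest.
- apply: le_trans k_sqrt; rewrite ler_nat -size_ps.
  exact: card_components_cover_graph.
(* The loss 4k is at most 4 sqrt n by [k_sqrt]. *)
rewrite num_colours_cover_graph; move: count_ps; rewrite -(ler_nat R) natrD natrM.
lra.
Qed.
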